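(* Let $\boldsymbol{A}$ be a symmetric positive semidefinite matrix with the spectral notation of the context, let the initial iterate $\boldsymbol{x}_0\in\mathbb{R}^n$ satisfy $\mathcal{P}_{\mathcal{Q}_1}(\boldsymbol{x}_0)\neq\boldsymbol{0}$, and let $\{\boldsymbol{x}_k\}$ be the sequence generated by the Split-Merge algorithm (defined in the context). There exists a threshold $\bar\delta\in(0,1]$ such that for any $\delta\in(0,\bar\delta)$ and any index $t\ge m_2$ exhibiting a strict eigen-gap $\lambda_t>\lambda_{t+1}$, whenever the intermediate eigenspace projections satisfy the attenuation conditions $$\sum_{j=m_1+1}^{t}(\boldsymbol{q}_j^T\boldsymbol{x}_k)^2\le\delta^2(\boldsymbol{q}_1^T\boldsymbol{x}_k)^2 \quad\text{and}\quad \sum_{j=m_1+1}^{t}(\boldsymbol{q}_j^T\boldsymbol{x}_k)^2\le\delta^2\sum_{j=t+1}^{r}(\boldsymbol{q}_j^T\boldsymbol{x}_k)^2,$$ the dynamic root $\tau_k$ of the spectral filter is bounded by $$\tau_k<\tfrac12(\lambda_1+\lambda_{t+1})+\mathcal{C}_{\text{gap}}\,\delta^2,$$ where $$\mathcal{C}_{\text{gap}}=\tfrac12(r-m_1)\left(1+\frac{4n^2\lambda_1(\lambda_1-\lambda_r)^2}{\lambda_r(\lambda_1-\lambda_{m_2+1})^2}\right)\lambda_{m_1+1}.$$ Moreover, the following two properties of the relative projections hold: (i) An exact recursive decay within the intermediate block, governed by the contraction $\mathcal{A}_k(\lambda_i)<1$: $$\left|\frac{\boldsymbol{q}_i^T\boldsymbol{x}_{k+1}}{\boldsymbol{q}_1^T\boldsymbol{x}_{k+1}}\right|=\frac{\lambda_i}{\lambda_1}\,\mathcal{A}_k(\lambda_i)\left|\frac{\boldsymbol{q}_i^T\boldsymbol{x}_k}{\boldsymbol{q}_1^T\boldsymbol{x}_k}\right|,\quad\forall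 i=m_1+1,\dots,t.$$ (ii) An attenuation bound across the subsequent eigenspace block: $$\left|\frac{\boldsymbol{q}_i^T\boldsymbol{x}_{k+1}}{\boldsymbol{q}_1^T\boldsymbol{x}_{k+1}}\right|<\frac{\lambda_t}{\lambda_1}\left|\frac{\boldsymbol{q}_i^T\boldsymbol{x}_k}{\boldsymbol{q}_1^T\boldsymbol{x}_k}\right|,\quad\forall i\ge t+1\text{ with }\lambda_i=\lambda_{t+1}.$$
   Context: Spectral notation: $\boldsymbol{A}\in\mathbb{R}^{n\times n}$ is symmetric positive semidefinite of rank $r$, $1\le r\le n$, with $\boldsymbol{A}=\boldsymbol{Q}\operatorname{diag}(\lambda_1,\dots,\lambda_n)\boldsymbol{Q}^T$, $\boldsymbol{Q}=[\boldsymbol{q}_1,\dots,\boldsymbol{q}_n]$ orthogonal, positive eigenvalues ordered as $\lambda_1=\dots=\lambda_{m_1}>\lambda_{m_1+1}=\dots=\lambda_{m_2}>\lambda_{m_2+1}\ge\dots\ge\lambda_r>0$, and the remaining $n-r$ eigenvalues equal to zero; $m_1$ and $m_2-m_1$ are the multiplicities of the two largest distinct eigenvalues. $\mathcal{Q}_1=\operatorname{span}\{\boldsymbol{q}_1,\dots,\boldsymbol{q}_{m_1}\}$ is the dominant eigenspace, $\mathcal{P}_{\mathcal{Q}_1}$ is the orthogonal projection onto $\mathcal{Q}_1$, and $\|\cdot\|$ is the Euclidean norm. Without loss of generality, the orthonormal basis of $\mathcal{Q}_1$ is chosen so that $\boldsymbol{q}_1=\mathcal{P}_{\mathcal{Q}_1}(\boldsymbol{x}_0)/\|\mathcal{P}_{\mathcal{Q}_1}(\boldsymbol{x}_0)\|$.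 Split-Merge algorithm: the inputs are $\boldsymbol{A}$, a tolerance $\epsilon>0$ and a safeguard $\epsilon_\sigma>0$ (e.g. $10^{-10}$); the initial vector satisfies $\boldsymbol{x}_0^T\boldsymbol{A}\boldsymbol{x}_0>0$. While the stopping criterion is not met, given $\boldsymbol{x}_k$, set $\mu_k=2(\boldsymbol{x}_k^T\boldsymbol{A}\boldsymbol{x}_k)^{1/2}$, $\alpha_k=\dfrac{\boldsymbol{x}_k^T\boldsymbol{A}^2\boldsymbol{x}_k}{\boldsymbol{x}_k^T\boldsymbol{A}\boldsymbol{x}_k}$, $\boldsymbol{r}_k=\boldsymbol{A}^2\boldsymbol{x}_k-\alpha_k\boldsymbol{A}\boldsymbol{x}_k$ (stop if $\|\boldsymbol{r}_k\|\le\epsilon$), $\gamma_k=\dfrac{\|\boldsymbol{r}_k\|^2}{(\boldsymbol{A}\boldsymbol{x}_k)^T\boldsymbol{r}_k}$, $\rho_k=\max\left\{1,\dfrac{\alpha_k}{\mu_k},\dfrac{\gamma_k}{\mu_k(1-\epsilon_\sigma)}\right\}$, $\sigma_k=1-\dfrac{\gamma_k}{\rho_k\mu_k}$, $\zeta_k=\dfrac1{\mu_k}-\dfrac{\alpha_k}{\mu_k^2\sigma_k\rho_k}$, $\omega_k=\dfrac1{\mu_k^2\sigma_k\rho_k}$, and update $\boldsymbol{x}_{k+1}=\zeta_k\boldsymbol{A}\boldsymbol{x}_k+\omega_k\boldsymbol{A}^2\boldsymbol{x}_k$. Equivalently, $\boldsymbol{x}_{k+1}=P_k(\boldsymbol{A})\boldsymbol{x}_k$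 with the quadratic spectral filter $P_k(\lambda)=\omega_k\lambda(\lambda-\tau_k)$, whose non-trivial (dynamic) root is $\tau_k=-\zeta_k/\omega_k=-\rho_k\mu_k+\alpha_k+\gamma_k$. The attenuation factor is $\mathcal{A}_k(\lambda)=\left|\dfrac{\lambda-\tau_k}{\lambda_1-\tau_k}\right|$.
   Formalization: In (ii) the strict inequality is claimed only when q_i^T x_k ≠ 0 (otherwise both sides are 0 and only ≤ holds); the safeguard is assumed to satisfy ε_σ < 1, and the claim concerns iterations k carried out before the stopping criterion is met. *)

(* Defs.v *)
From HB Require Import structures.
From mathcomp Require Export all_boot all_order all_algebra.
From mathcomp Require Export reals.

Set Implicit Arguments.
Unset Strict Implicit.
Unset Printing Implicit Defensive.

Import Order.TTheory GRing.Theory Num.Theory.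

Local Open Scope ring_scope.

Section Euclidean.
Context {R : realType} {n : nat}.

Definition dot (u v : 'cV[R]_n) : R := (u^T *m v) 0 0.

(* The norm that MathComp-Analysis puts on matrices is the sup norm. *)
Definition enorm (u : 'cV[R]_n) : R := Num.sqrt (dot u u).

(* Orthogonal projection onto the row space of U: [kermx U^T] spans the
   orthogonal complement of that row space. *)
Definition orth_proj (U : 'M[R]_n) (x : 'cV[R]_n) : 'cV[R]_n :=
  (x^T *m proj_mx U (kermx U^T))^T.

End Euclidean.

Section Spectral.
Context {R : realType} {n : nat}.

(* Eigenpairs are indexed from 1 to n: [lam j] and [q j] stand for lambda_j and
   q_j, and their values at 0 and beyond n are irrelevant. *)
Definition eigvec_mx (q : nat -> 'cV[R]_n) : 'M[R]_n :=
  \matrix_(i, j) q j.+1 i 0.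

Definition eigval_mx (lam : nat -> R) : 'M[R]_n :=
  diag_mx (\row_j lam j.+1).

Definition dominant_eigenspace (m1 : nat) (q : nat -> 'cV[R]_n) : 'M[R]_n :=
  (\sum_(1 <= j < m1.+1) <<(q j)^T>>)%MS.

(* The range m2 + 1, ..., r may be empty; then lambda_{m2 + 1} = 0 if m2 < n. *)
Record spectral_notation (A : 'M[R]_n) (r m1 m2 : nat)
    (lam : nat -> R) (q : nat -> 'cV[R]_n) : Prop := SpectralNotation {
  sn_sym : A^T = A;
  sn_psd : forall v : 'cV[R]_n, 0 <= dot v (A *m v);
  sn_rank : \rank A = r;
  sn_r_bounds : (1 <= r <= n)%N;
  sn_orthogonal : (eigvec_mx q)^T *m eigvec_mx q = 1%:M;
  sn_decomposition :
    A = eigvec_mx q *m eigval_mx lam *m (eigvec_mx q)^T;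
  sn_m_bounds : [/\ 1 <= m1, m1 < m2 & m2 <= r]%N;
  sn_block1 : forall j, (1 <= j <= m1)%N -> lam j = lam 1%N;
  sn_gap1 : lam m1.+1 < lam m1;
  sn_block2 : forall j, (m1 < j <= m2)%N -> lam j = lam m1.+1;
  sn_gap2 : (m2 < n)%N -> lam m2.+1 < lam m2;
  sn_tail : forall i j, (m2 < i)%N -> (i <= j)%N -> (j <= r)%N ->
    lam j <= lam i;
  sn_positive : 0 < lam r;
  sn_zero : forall j, (r < j <= n)%N -> lam j = 0
}.

End Spectral.

Section SplitMerge.
Context {R : realType} {n : nat}.
Variables (A : 'M[R]_n) (eps_sigma : R).
Implicit Types x : 'cV[R]_n.

Definition sm_mu x : R := 2 * Num.sqrt (dot x (A *m x)).

Definition sm_alpha x : R := dot x (A *m (A *m x)) / dot x (A *m x).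

Definition sm_res x : 'cV[R]_n :=
  A *m (A *m x) - sm_alpha x *: (A *m x).

Definition sm_gamma x : R :=
  enorm (sm_res x) ^+ 2 / dot (A *m x) (sm_res x).

Definition sm_rho x : R :=
  Num.max 1 (Num.max (sm_alpha x / sm_mu x)
                     (sm_gamma x / (sm_mu x * (1 - eps_sigma)))).

Definition sm_sigma x : R := 1 - sm_gamma x / (sm_rho x * sm_mu x).

Definition sm_zeta x : R :=
  (sm_mu x)^-1 - sm_alpha x / (sm_mu x ^+ 2 * sm_sigma x * sm_rho x).

Definition sm_omega x : R := (sm_mu x ^+ 2 * sm_sigma x * sm_rho x)^-1.

Definition sm_step x : 'cV[R]_n :=
  sm_zeta x *: (A *m x) + sm_omega x *: (A *m (A *m x)).

Definition sm_iterate (x0 : 'cV[R]_n) (k : nat) : 'cV[R]_n :=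
  iter k sm_step x0.

(* The algorithm has not stopped at any of the iterates 0, ..., k, so that
   iteration k is carried out and produces the iterate k + 1. *)
Definition sm_runs (eps : R) (x0 : 'cV[R]_n) (k : nat) : Prop :=
  forall j, (j <= k)%N -> eps < enorm (sm_res (sm_iterate x0 j)).

(* Dynamic root of P_k(l) = omega_k l (l - tau_k). *)
Definition sm_tau x : R := - (sm_zeta x / sm_omega x).

Definition attenuation (lam1 : R) x (l : R) : R :=
  `|(l - sm_tau x) / (lam1 - sm_tau x)|.

End SplitMerge.

Definition C_gap {R : realType} (n r m1 m2 : nat) (lam : nat -> R) : R :=
  2^-1 * (r - m1)%:R *
  (1 + 4 * n%:R ^+ 2 * lam 1%N * (lam 1%N - lam r) ^+ 2
       / (lam r * (lam 1%N - lam m2.+1) ^+ 2)) * lam m1.+1.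

(* Main.v *)
(* Write [a_i] for the coordinates of the iterate in the eigenbasis and give
   [lam_i] the weight [lam_i a_i^2]: then [alpha] is the weighted mean of the
   eigenvalues and [gamma] is their mean for the weights
   [lam_i a_i^2 (lam_i - alpha)^2].  The safeguards in [rho] give [tau < alpha]
   and [tau <= gamma], so it suffices to bound [alpha + gamma].
   Put [z = lam - alpha], [M = lam_1 - alpha], [m = lam_(t+1) - alpha].  The
   bound on [alpha + gamma] says that the third moment of [z] is at most
   [M + m + 2 C delta^2] times its second moment.  For [m >= 0] this follows
   from [z <= M].  For [m < 0], take the mean of [z (z - M) (z - m)]: it is
   nonpositive off the intermediate block, and on that block it is at most
   [lam_1 m^2 / 4], which the second attenuation condition absorbs into the
   second moment of the block beyond [t].
   With [g] the smallest positive gap between consecutive eigenvalues,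
   [4 lam_1 C delta^2 <= g^2] makes both contraction properties hold. *)
Require Import Defs.
From mathcomp Require Import ring lra.

Import Order.TTheory GRing.Theory Num.Theory.
Local Open Scope ring_scope.

Set Implicit Arguments.
Unset Strict Implicit.

(** * Finite sums and weighted third moments *)

Lemma sumr_gt0_ex (R : realFieldType) (I : finType) (F : I -> R) (i : I) :
  (forall j, 0 <= F j) -> 0 < F i -> 0 < \sum_j F j.
Proof.
move=> F0 Fi; rewrite (bigD1 i) //=.
by apply: ltr_wpDr => //; apply: sumr_ge0 => j _.
Qed.

(** Bridges the 1-based ranges of the statement and sums over ordinals, where [i] stands for the
    eigenpair [i + 1]. *)
Lemma sum_nat_ord (R : realType) (n a b : nat) (F : nat -> R) : (b <= n)%N ->
  \sum_(a.+1 <= j < b.+1) F j = \sum_(i < n | (a <= i < b)%N) F i.+1.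
Proof.
move=> bn; rewrite big_add1 /= big_geq_mkord /=.
by rewrite (big_ord_widen_cond n (fun i => a <= i)%N (fun i => F i.+1)).
Qed.

(** Write [z^3 = (M + m) z^2 - M m z + z (z - M) (z - m)]; the linear term averages to zero. For
    [m < 0] the last product is nonpositive where [z = M] or [z <= m], so only [B] needs an
    assumption. *)
Lemma third_moment_le (R : realFieldType) (I : finType) (B : pred I)
    (w z : I -> R) (M m e : R) :
  (forall i, 0 <= w i) -> \sum_i w i * z i = 0 -> (forall i, z i <= M) ->
  (forall i, ~~ B i -> z i = M \/ z i <= m) -> 0 <= e ->
  (m < 0 -> \sum_(i | B i) w i * (z i * (z i - M) * (z i - m))
              <= e * \sum_i w i * z i ^+ 2) ->
  \sum_i w i * z i ^+ 3 <= (M + m + e) * \sum_i w i * z i ^+ 2.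
Proof.
move=> w0 mean0 zM offB e0 onB.
have V0 : 0 <= \sum_i w i * z i ^+ 2.
  by apply: sumr_ge0 => i _; rewrite mulr_ge0 ?sqr_ge0.
have [m0|m0] := leP 0 m.
  apply: (@le_trans _ _ (M * \sum_i w i * z i ^+ 2)).
    rewrite mulr_sumr; apply: ler_sum => i _.
    rewrite [leRHS]mulrCA; apply: ler_wpM2l => //; rewrite exprS.
    by apply: ler_wpM2r; rewrite ?sqr_ge0.
  by apply: ler_wpM2r => //; lra.
have -> : \sum_i w i * z i ^+ 3 = (M + m) * (\sum_i w i * z i ^+ 2)
    - M * m * (\sum_i w i * z i) + \sum_i w i * (z i * (z i - M) * (z i - m)).
  rewrite !mulr_sumr -sumrB -big_split /=; apply: eq_bigr => i _; ring.
rewrite mean0 mulr0 subr0 [leRHS]mulrDl lerD2l.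
apply: le_trans (onB m0); rewrite (bigID B) /= gerDl.
apply: sumr_le0 => i /offB zi; rewrite mulr_ge0_le0 //.
case: zi => [->|zm]; first by rewrite subrr mulr0 mul0r.
have := zM i => ?; apply: mulr_ge0_le0; last lra.
by apply: mulr_le0; lra.
Qed.

(** On [[0, M]] the product is nonpositive; on [[m, 0]] completing the square gives
    [(-z) (z - m) <= m^2 / 4], and [M - z <= L]. *)
Lemma cubic_le (R : realFieldType) (z M m L : R) :
  m < 0 -> m <= z <= M -> M - m <= L ->
  z * (z - M) * (z - m) <= L * (m ^+ 2 / 4).
Proof.
move=> m0 /andP[mz zM] ML.
have L0 : 0 <= L by lra.
have [z0|z0] := leP 0 z.
  apply: (@le_trans _ _ 0); last by rewrite mulr_ge0 // divr_ge0 ?sqr_ge0.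
  have : 0 <= z * (M - z) by apply: mulr_ge0; lra.
  nra.
have -> : z * (z - M) * (z - m) = (M - z) * ((- z) * (z - m)) by ring.
apply: ler_pM; [lra| |lra|].
  by apply: mulr_ge0; lra.
have := sqr_ge0 (z - m / 2); nra.
Qed.

(** Applies [third_moment_le] with [z = l - al], [M = l1 - al], [m = lt - al]. Per unit of [a^2],
    [B] costs at most [l1 lB m^2 / 4] and [T] supplies at least [lr m^2]; [4 K lr >= l1 lB] balances
    the two. *)
Lemma third_moment_split (R : realFieldType) (I : finType)
    (B T : pred I) (l a : I -> R) (al l1 lB lt lr d K : R) :
  0 < lr -> 0 <= lt -> 0 <= K -> 4 * K * lr >= l1 * lB ->
  (forall i, 0 <= l i <= l1) ->
  \sum_i l i * a i ^+ 2 * (l i - al) = 0 ->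
  (forall i, B i -> lt <= l i <= lB) ->
  (forall i, ~~ B i -> l i = l1 \/ l i <= lt) ->
  (forall i, T i -> lr <= l i <= lt) ->
  \sum_(i | B i) a i ^+ 2 <= d * \sum_(i | T i) a i ^+ 2 -> 0 <= d ->
  \sum_i l i * a i ^+ 2 * (l i - al) ^+ 3 <=
  (l1 + lt - 2 * al + K * d) * \sum_i l i * a i ^+ 2 * (l i - al) ^+ 2.
Proof.
move=> lr0 lt0 K0 HK hl mean0 hB hnB hT hBT d0.
have -> : l1 + lt - 2 * al + K * d = (l1 - al) + (lt - al) + K * d by ring.
have w0 i : 0 <= l i * a i ^+ 2.
  by case/andP: (hl i) => ? _; rewrite mulr_ge0 ?sqr_ge0.
apply: (@third_moment_le _ _ B) => //.
- by move=> i; case/andP: (hl i) => _ ?; lra.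
- by move=> i /hnB[->|?]; [left|right; lra].
- by rewrite mulr_ge0.
move=> al_gt; have m0 := al_gt; set m := lt - al in m0 *.
(* Since [lt >= 0], [M - m <= l1], so [cubic_le] applies with [L = l1]. *)
apply: (@le_trans _ _ (\sum_(i | B i) lB * a i ^+ 2 * (l1 * (m ^+ 2 / 4)))).
  apply: ler_sum => i Bi.
  have /andP[l0 ll1] := hl i; have /andP[tl lB'] := hB i Bi.
  apply: (@le_trans _ _ (l i * a i ^+ 2 * (l1 * (m ^+ 2 / 4)))).
    apply: ler_wpM2l => //; apply: cubic_le => //; rewrite /m; lra.
  apply: ler_wpM2r.
    by apply: mulr_ge0; [lra | apply: divr_ge0; rewrite ?sqr_ge0 ?ler0n].
  by apply: ler_wpM2r; rewrite ?sqr_ge0.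
rewrite -mulr_suml -mulr_sumr.
(* Only [T] is kept from the second moment; there [l <= lt < al] gives [(l - al)^2 >= m^2]. *)
apply: (@le_trans _ _ (K * d * (lr * m ^+ 2 * \sum_(i | T i) a i ^+ 2))); last first.
  apply: ler_wpM2l; first exact: mulr_ge0.
  apply: (@le_trans _ _ (\sum_(i | T i) l i * a i ^+ 2 * (l i - al) ^+ 2)).
    rewrite mulr_sumr; apply: ler_sum => i /hT /andP[rl lti].
    rewrite mulrAC; apply: ler_pM; rewrite ?sqr_ge0 //.
    + by rewrite mulr_ge0 ?sqr_ge0 // ltW.
    + by apply: ler_wpM2r; rewrite ?sqr_ge0.
    + rewrite -sqrrN -[leRHS]sqrrN; apply: lerXn2r; rewrite ?nnegrE /m; lra.
  rewrite [leRHS](bigID T) /= lerDl.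
  by apply: sumr_ge0 => i _; rewrite mulr_ge0 ?sqr_ge0.
set SB := \sum_(i | B i) _ in hBT *; set ST := \sum_(i | T i) _ in hBT *.
have SB0 : 0 <= SB by apply: sumr_ge0 => i _; rewrite sqr_ge0.
have m20 : 0 <= m ^+ 2 by rewrite sqr_ge0.
apply: (@le_trans _ _ (K * lr * m ^+ 2 * SB)).
  have -> : lB * SB * (l1 * (m ^+ 2 / 4)) = (l1 * lB / 4) * (m ^+ 2 * SB).
    by field.
  rewrite -[leRHS]mulrA; apply: ler_wpM2r; first exact: mulr_ge0.
  lra.
have -> : K * d * (lr * m ^+ 2 * ST) = K * lr * m ^+ 2 * (d * ST) by ring.
by apply: ler_wpM2l => //; rewrite mulr_ge0 // mulr_ge0 // ltW.
Qed.

(** * Inner product and orthogonal projection *)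

Lemma dotE (R : realType) (n : nat) (u v : 'cV[R]_n) :
  dot u v = \sum_i u i 0 * v i 0.
Proof. by rewrite /dot mxE; apply: eq_bigr => i _; rewrite mxE. Qed.

Lemma dotDr (R : realType) (n : nat) (u v w : 'cV[R]_n) :
  dot u (v + w) = dot u v + dot u w.
Proof. by rewrite /dot mulmxDr mxE. Qed.

Lemma dotZr (R : realType) (n : nat) (c : R) (u v : 'cV[R]_n) :
  dot u (c *: v) = c * dot u v.
Proof. by rewrite /dot -scalemxAr mxE. Qed.

Lemma dotZl (R : realType) (n : nat) (c : R) (u v : 'cV[R]_n) :
  dot (c *: u) v = c * dot u v.
Proof. by rewrite /dot linearZ /= -scalemxAl mxE. Qed.

Lemma dotBr (R : realType) (n : nat) (u v w : 'cV[R]_n) :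
  dot u (v - w) = dot u v - dot u w.
Proof. by rewrite dotDr -scaleN1r dotZr mulN1r. Qed.

Lemma dot_eq0 (R : realType) (n : nat) (u : 'cV[R]_n) :
  (dot u u == 0) = (u == 0).
Proof.
apply/eqP/eqP => [|->]; last by rewrite /dot mulmx0 mxE.
rewrite dotE => /psumr_eq0P u0; apply/matrixP => i j; rewrite ord1 mxE.
have /eqP := u0 (fun i _ => sqr_ge0 (u i 0)) i isT.
by rewrite mulf_eq0 orbb => /eqP.
Qed.

Lemma enorm_sqr (R : realType) (n : nat) (u : 'cV[R]_n) :
  enorm u ^+ 2 = dot u u.
Proof.
by rewrite sqr_sqrtr // dotE; apply: sumr_ge0 => i _; rewrite -expr2 sqr_ge0.
Qed.

(** A row [v = w U] with [v U^T = 0] satisfies [v v^T = v U^T w^T = 0]. *)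
Lemma capmx_orth (R : realType) (n : nat) (U : 'M[R]_n) :
  (U :&: kermx U^T)%MS = 0.
Proof.
apply/eqP/rowV0P => v; rewrite sub_capmx => /andP[/submxP[w ->] /sub_kermxP wU].
apply: trmx_inj; rewrite trmx0; apply/eqP; rewrite -dot_eq0 /dot trmxK.
by rewrite trmx_mul mulmxA wU mul0mx mxE.
Qed.

Lemma addmx_orth_full (R : realType) (n : nat) (U : 'M[R]_n) :
  row_full (U + kermx U^T)%MS.
Proof.
have := mxrank_sum_cap U (kermx U^T).
rewrite capmx_orth mxrank0 addn0 mxrank_ker mxrank_tr => rk.
by rewrite /row_full rk subnKC // rank_leq_col.
Qed.

(** The projection lies in the row space of [U], and the remainder of [x] in its orthogonal
    complement. *)
Lemma dot_orth_proj (R : realType) (n : nat) (U : 'M[R]_n) (x : 'cV[R]_n) :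
  dot (orth_proj U x) x = dot (orth_proj U x) (orth_proj U x).
Proof.
have xin : (x^T <= U + kermx U^T)%MS by rewrite submx_full ?addmx_orth_full.
have /submxP[w Pw] := proj_mx_sub U (kermx U^T) x^T.
have /sub_kermxP := proj_mx_compl_sub xin; rewrite Pw => cU.
have {}cU : U *m (x - (w *m U)^T) = 0.
  by apply: trmx_inj; rewrite trmx_mul linearB /= trmxK cU trmx0.
apply/eqP; rewrite -subr_eq0 -dotBr /orth_proj /dot trmxK Pw.
by rewrite -mulmxA cU mulmx0 mxE.
Qed.

(** * Eigencoordinates and the order of the eigenvalues *)

Lemma eigvec_coord (R : realType) (n : nat) (q : nat -> 'cV[R]_n) (u : 'cV[R]_n)
    (i : 'I_n) :
  ((eigvec_mx q)^T *m u) i 0 = dot (q i.+1) u.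
Proof. by rewrite dotE mxE; apply: eq_bigr => j _; rewrite !mxE. Qed.

Lemma parseval (R : realType) (n : nat) (q : nat -> 'cV[R]_n) (u v : 'cV[R]_n) :
  (eigvec_mx q)^T *m eigvec_mx q = 1%:M ->
  dot u v = \sum_(i < n) dot (q i.+1) u * dot (q i.+1) v.
Proof.
move=> /mulmx1C Q1; rewrite /dot -[u^T]mulmx1 -Q1 -mulmxA -mulmxA mulmxA.
rewrite -[u^T *m _]trmxK trmx_mul trmxK mxE; apply: eq_bigr => i _.
by rewrite mxE !eigvec_coord.
Qed.

Lemma dot_eigvec (R : realType) (n r m1 m2 : nat) (A : 'M[R]_n)
    (lam : nat -> R) (q : nat -> 'cV[R]_n) (u : 'cV[R]_n) (i : 'I_n) :
  spectral_notation A r m1 m2 lam q ->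
  dot (q i.+1) (A *m u) = lam i.+1 * dot (q i.+1) u.
Proof.
move=> hA; rewrite -eigvec_coord (sn_decomposition hA) !mulmxA.
rewrite (sn_orthogonal hA) mul1mx -mulmxA mul_diag_mx mxE eigvec_coord.
by rewrite mxE.
Qed.

(** The record gives the order block by block; the induction compares neighbours and treats the
    borders [m1], [m2] and [r] separately. *)
Lemma lam_le (R : realType) (n r m1 m2 : nat) (A : 'M[R]_n)
    (lam : nat -> R) (q : nat -> 'cV[R]_n) (i j : nat) :
  spectral_notation A r m1 m2 lam q ->
  (1 <= i)%N -> (i <= j)%N -> (j <= n)%N -> lam j <= lam i.
Proof.
move=> hA i1; elim: j => [|j IH]; first by rewrite leqn0 => /eqP ->.
rewrite leq_eqVlt => /orP[/eqP-> //|ij jn].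
apply: le_trans (IH _ (ltnW jn)) => //.
have j1 : (1 <= j)%N := leq_trans i1 ij.
have [m1_ge1 m12 m2r] := sn_m_bounds hA.
have [jm1|m1j] := ltnP j m1.
  have -> : lam j.+1 = lam 1%N by apply: (sn_block1 hA); rewrite jm1.
  by have -> : lam j = lam 1%N by apply: (sn_block1 hA); rewrite j1 ltnW.
have [<-|jm1] := eqVneq m1 j; first exact/ltW/(sn_gap1 hA).
have {jm1}m1j : (m1 < j)%N by rewrite ltn_neqAle jm1.
have [jm2|m2j] := ltnP j m2.
  have -> : lam j.+1 = lam m1.+1 by apply: (sn_block2 hA); rewrite jm2 ltnW.
  by have -> : lam j = lam m1.+1 by apply: (sn_block2 hA); rewrite m1j ltnW.
have [jm2|jm2] := eqVneq m2 j; first by rewrite -jm2 in jn *; exact/ltW/(sn_gap2 hA).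
have {jm2}m2j : (m2 < j)%N by rewrite ltn_neqAle jm2.
have [jr|rj] := ltnP j r; first by apply: (sn_tail hA).
have -> : lam j.+1 = 0 by apply: (sn_zero hA); rewrite ltnS rj.
have [<-|rj'] := eqVneq r j; first exact/ltW/(sn_positive hA).
by have -> : lam j = 0 by apply: (sn_zero hA); rewrite ltn_neqAle rj' rj ltnW.
Qed.

Lemma lam_gt0 (R : realType) (n r m1 m2 : nat) (A : 'M[R]_n)
    (lam : nat -> R) (q : nat -> 'cV[R]_n) (i : nat) :
  spectral_notation A r m1 m2 lam q -> (1 <= i <= r)%N -> 0 < lam i.
Proof.
move=> hA /andP[i1 ir]; have /andP[_ rn] := sn_r_bounds hA.
by apply: lt_le_trans (sn_positive hA) _; apply: (lam_le hA).
Qed.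

Lemma lam_ge0 (R : realType) (n r m1 m2 : nat) (A : 'M[R]_n)
    (lam : nat -> R) (q : nat -> 'cV[R]_n) (i : nat) :
  spectral_notation A r m1 m2 lam q -> (1 <= i <= n)%N -> 0 <= lam i.
Proof.
move=> hA /andP[i1 iN]; have [ir|ri] := leqP i r.
  by apply/ltW/(lam_gt0 hA); rewrite i1.
by rewrite (sn_zero hA) ?ri.
Qed.

(** * Step parameters and the dynamic root *)

Lemma sm_mu_gt0 (R : realType) (n : nat) (A : 'M[R]_n) (x : 'cV[R]_n) :
  0 < dot x (A *m x) -> 0 < sm_mu A x.
Proof. by move=> S0; rewrite mulr_gt0 ?sqrtr_gt0. Qed.

Lemma sm_rho_ge1 (R : realType) (n : nat) (A : 'M[R]_n) (es : R)
    (x : 'cV[R]_n) : 1 <= sm_rho A es x.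
Proof. by rewrite /sm_rho le_max lexx. Qed.

Lemma sm_rho_gt0 (R : realType) (n : nat) (A : 'M[R]_n) (es : R)
    (x : 'cV[R]_n) : 0 < sm_rho A es x.
Proof. exact: lt_le_trans ltr01 (sm_rho_ge1 _ _ _). Qed.

(** These are the second and third entries of the maximum, cleared of denominators. The former
    yields [tau <= gamma], the latter [sigma > 0]. *)
Lemma sm_rho_mu_ge (R : realType) (n : nat) (A : 'M[R]_n) (es : R)
    (x : 'cV[R]_n) : 0 < dot x (A *m x) -> 0 < es < 1 ->
  sm_alpha A x <= sm_rho A es x * sm_mu A x /\
  sm_gamma A x <= sm_rho A es x * sm_mu A x * (1 - es).
Proof.
move=> /sm_mu_gt0 mu0 /andP[es0 es1].
have e1 : 0 < 1 - es by lra.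
split; last rewrite -mulrA.
  by rewrite -ler_pdivrMr // /sm_rho !le_max lexx orbT.
by rewrite -ler_pdivrMr /sm_rho ?le_max ?lexx ?orbT // mulr_gt0.
Qed.

Lemma sm_sigma_gt0 (R : realType) (n : nat) (A : 'M[R]_n) (es : R)
    (x : 'cV[R]_n) : 0 < dot x (A *m x) -> 0 < es < 1 -> 0 < sm_sigma A es x.
Proof.
move=> S0 es01; have mu0 := sm_mu_gt0 S0; have [_ gle] := sm_rho_mu_ge S0 es01.
have rm0 : 0 < sm_rho A es x * sm_mu A x.
  by rewrite mulr_gt0 ?sm_rho_gt0.
case/andP: es01 => es0 es1; rewrite /sm_sigma subr_gt0 ltr_pdivrMr // mul1r.
by apply: le_lt_trans gle _; rewrite gtr_pMr //; lra.
Qed.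

Lemma sm_omega_gt0 (R : realType) (n : nat) (A : 'M[R]_n) (es : R)
    (x : 'cV[R]_n) : 0 < dot x (A *m x) -> 0 < es < 1 -> 0 < sm_omega A es x.
Proof.
move=> S0 es01; have mu0 := sm_mu_gt0 S0; have s0 := sm_sigma_gt0 S0 es01.
by rewrite invr_gt0 mulr_gt0 ?sm_rho_gt0 // mulr_gt0 // exprn_gt0.
Qed.

Lemma sm_tauE (R : realType) (n : nat) (A : 'M[R]_n) (es : R)
    (x : 'cV[R]_n) : 0 < dot x (A *m x) -> 0 < es < 1 ->
  sm_tau A es x = sm_alpha A x - sm_rho A es x * sm_mu A x * sm_sigma A es x.
Proof.
move=> S0 es01; have mu0 := sm_mu_gt0 S0; have s0 := sm_sigma_gt0 S0 es01.
have r0 := sm_rho_gt0 A es x.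
rewrite /sm_tau /sm_zeta /sm_omega.
by field; rewrite !gt_eqF.
Qed.

Lemma sm_tau_lt_alpha (R : realType) (n : nat) (A : 'M[R]_n) (es : R)
    (x : 'cV[R]_n) : 0 < dot x (A *m x) -> 0 < es < 1 ->
  sm_tau A es x < sm_alpha A x.
Proof.
move=> S0 es01; have mu0 := sm_mu_gt0 S0; have s0 := sm_sigma_gt0 S0 es01.
by rewrite sm_tauE // ltrBlDr ltrDl mulr_gt0 // mulr_gt0 // sm_rho_gt0.
Qed.

(** As [rho mu sigma = rho mu - gamma], the root is [alpha + gamma - rho mu], and
    [alpha <= rho mu]. *)
Lemma sm_tau_le_gamma (R : realType) (n : nat) (A : 'M[R]_n) (es : R)
    (x : 'cV[R]_n) : 0 < dot x (A *m x) -> 0 < es < 1 ->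
  sm_tau A es x <= sm_gamma A x.
Proof.
move=> S0 es01; have mu0 := sm_mu_gt0 S0; have [ale _] := sm_rho_mu_ge S0 es01.
have r0 := sm_rho_gt0 A es x.
rewrite sm_tauE // /sm_sigma mulrBr mulr1 [X in _ - (_ - X)]mulrC divfK; first lra.
by rewrite mulf_neq0 ?gt_eqF.
Qed.

(** The filter appears through [zeta l + omega l^2 = omega l (l - tau)]. *)
Lemma dot_sm_step (R : realType) (n : nat) (A : 'M[R]_n) (es : R)
    (x v : 'cV[R]_n) (l : R) : 0 < dot x (A *m x) -> 0 < es < 1 ->
  (forall u, dot v (A *m u) = l * dot v u) ->
  dot v (sm_step A es x) =
  sm_omega A es x * (l * (l - sm_tau A es x)) * dot v x.
Proof.
move=> S0 es01 eig; have w0 := sm_omega_gt0 S0 es01.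
rewrite /sm_step dotDr !dotZr !eig /sm_tau.
by field; rewrite gt_eqF.
Qed.

(** * Spectral expansions of the residual, [alpha] and [gamma] *)

Lemma dot_mulmx_spectral (R : realType) (n r m1 m2 : nat) (A : 'M[R]_n)
    (lam : nat -> R) (q : nat -> 'cV[R]_n) (x : 'cV[R]_n) :
  spectral_notation A r m1 m2 lam q ->
  dot x (A *m x) = \sum_(i < n) lam i.+1 * dot (q i.+1) x ^+ 2.
Proof.
move=> hA; rewrite (parseval _ _ (sn_orthogonal hA)); apply: eq_bigr => i _.
rewrite (dot_eigvec _ _ hA); ring.
Qed.

Lemma dot_mulmx2_spectral (R : realType) (n r m1 m2 : nat) (A : 'M[R]_n)
    (lam : nat -> R) (q : nat -> 'cV[R]_n) (x : 'cV[R]_n) :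
  spectral_notation A r m1 m2 lam q ->
  dot x (A *m (A *m x)) = \sum_(i < n) lam i.+1 ^+ 2 * dot (q i.+1) x ^+ 2.
Proof.
move=> hA; rewrite (parseval _ _ (sn_orthogonal hA)); apply: eq_bigr => i _.
rewrite !(dot_eigvec _ _ hA); ring.
Qed.

Lemma dot_sm_res (R : realType) (n r m1 m2 : nat) (A : 'M[R]_n)
    (lam : nat -> R) (q : nat -> 'cV[R]_n) (x : 'cV[R]_n) (i : 'I_n) :
  spectral_notation A r m1 m2 lam q ->
  dot (q i.+1) (sm_res A x) =
  lam i.+1 * (lam i.+1 - sm_alpha A x) * dot (q i.+1) x.
Proof.
move=> hA; rewrite dotBr dotZr !(dot_eigvec _ _ hA); ring.
Qed.

(** A nonzero residual coordinate [lam (lam - alpha) a] has three nonzero factors. The witness makes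
    the denominators of [alpha] and [gamma] positive. *)
Lemma sm_res_ex (R : realType) (n r m1 m2 : nat) (A : 'M[R]_n)
    (lam : nat -> R) (q : nat -> 'cV[R]_n) (x : 'cV[R]_n) :
  spectral_notation A r m1 m2 lam q -> 0 < enorm (sm_res A x) ->
  exists i : 'I_n, [/\ 0 < lam i.+1, lam i.+1 != sm_alpha A x
                     & dot (q i.+1) x != 0].
Proof.
move=> hA; rewrite sqrtr_gt0 (parseval _ _ (sn_orthogonal hA)) => /lt0r_neq0/eqP.
case/psumr_neq0P => [i _|i /= res_i]; first by rewrite -expr2 sqr_ge0.
move: res_i; rewrite -expr2 (dot_sm_res _ _ hA) exprn_even_gt0 //=.
rewrite !mulf_eq0 !negb_or subr_eq0.
case/andP => /andP[l0 la] a0; exists i; split=> //.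
by rewrite lt0r l0 (lam_ge0 hA) //= ltn_ord.
Qed.

Lemma dot_mulmx_gt0 (R : realType) (n r m1 m2 : nat) (A : 'M[R]_n)
    (lam : nat -> R) (q : nat -> 'cV[R]_n) (x : 'cV[R]_n) :
  spectral_notation A r m1 m2 lam q -> 0 < enorm (sm_res A x) ->
  0 < dot x (A *m x).
Proof.
move=> hA /(sm_res_ex hA)[i [l0 _ a0]]; rewrite (dot_mulmx_spectral _ hA).
apply: (sumr_gt0_ex (i := i)) => [j|].
  by rewrite mulr_ge0 ?sqr_ge0 // (lam_ge0 hA) //= ltn_ord.
by rewrite mulr_gt0 // exprn_even_gt0.
Qed.

Lemma sm_alpha_mean (R : realType) (n r m1 m2 : nat) (A : 'M[R]_n)
    (lam : nat -> R) (q : nat -> 'cV[R]_n) (x : 'cV[R]_n) :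
  spectral_notation A r m1 m2 lam q -> 0 < dot x (A *m x) ->
  \sum_(i < n) lam i.+1 * dot (q i.+1) x ^+ 2 * (lam i.+1 - sm_alpha A x) = 0.
Proof.
move=> hA S0.
have : dot x (A *m (A *m x)) - sm_alpha A x * dot x (A *m x) = 0.
  by rewrite /sm_alpha divfK ?subrr // gt_eqF.
rewrite (dot_mulmx_spectral _ hA) (dot_mulmx2_spectral _ hA) mulr_sumr -sumrB.
by move=> E; rewrite -[RHS]E; apply: eq_bigr => i _; ring.
Qed.

Lemma sm_alpha_le (R : realType) (n r m1 m2 : nat) (A : 'M[R]_n)
    (lam : nat -> R) (q : nat -> 'cV[R]_n) (x : 'cV[R]_n) :
  spectral_notation A r m1 m2 lam q -> 0 < dot x (A *m x) ->
  sm_alpha A x <= lam 1%N.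
Proof.
move=> hA S0; rewrite /sm_alpha ler_pdivrMr //.
rewrite (dot_mulmx_spectral _ hA) (dot_mulmx2_spectral _ hA) mulr_sumr.
apply: ler_sum => i _; rewrite [leRHS]mulrA.
apply: ler_wpM2r; rewrite ?sqr_ge0 // expr2.
by apply: ler_wpM2r; [rewrite (lam_ge0 hA) //= | rewrite (lam_le hA)].
Qed.

(* [gamma] is a weighted mean of the eigenvalues: the second moment about
   [alpha] is [(A x)^T r], because the weights [lam_i a_i^2] have mean [alpha]. *)
Lemma sm_gamma_moment (R : realType) (n r m1 m2 : nat) (A : 'M[R]_n)
    (lam : nat -> R) (q : nat -> 'cV[R]_n) (x : 'cV[R]_n) (c : R) :
  spectral_notation A r m1 m2 lam q -> 0 < enorm (sm_res A x) ->
  \sum_(i < n) lam i.+1 * dot (q i.+1) x ^+ 2 * (lam i.+1 - sm_alpha A x) ^+ 3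
  <= (c - sm_alpha A x) *
    \sum_(i < n) lam i.+1 * dot (q i.+1) x ^+ 2
                 * (lam i.+1 - sm_alpha A x) ^+ 2 ->
  sm_gamma A x <= c.
Proof.
move=> hA res0; have mean := sm_alpha_mean hA (dot_mulmx_gt0 hA res0).
set al := sm_alpha A x in mean *.
set V := \sum_(i < n) _ * _ ^+ 2 => cub.
have V0 : 0 < V.
  have [i [l0 la a0]] := sm_res_ex hA res0.
  apply: (sumr_gt0_ex (i := i)) => [j|].
    rewrite mulr_ge0 ?sqr_ge0 // mulr_ge0 ?sqr_ge0 //.
    by rewrite (lam_ge0 hA) //= ltn_ord.
  apply: mulr_gt0; last by rewrite exprn_even_gt0 //= subr_eq0.
  by rewrite mulr_gt0 // exprn_even_gt0.
(* In [lam^2 a^2 (lam - al)^2] one factor [lam] is written [al + (lam - al)]. *)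
have num : enorm (sm_res A x) ^+ 2 = al * V +
  \sum_(i < n) lam i.+1 * dot (q i.+1) x ^+ 2 * (lam i.+1 - al) ^+ 3.
  rewrite enorm_sqr (parseval _ _ (sn_orthogonal hA)) mulr_sumr -big_split /=.
  by apply: eq_bigr => i _; rewrite !(dot_sm_res _ _ hA) -/al; ring.
(* The same splitting of [lam^2 a^2 (lam - al)]; its extra term is [al] times the vanishing first
   moment. *)
have den : dot (A *m x) (sm_res A x) = V.
  rewrite -[RHS]addr0 -[X in _ + X](mulr0 al) -mean mulr_sumr -big_split /=.
  rewrite (parseval _ _ (sn_orthogonal hA)).
  apply: eq_bigr => i _.
  by rewrite (dot_sm_res _ _ hA) (dot_eigvec _ _ hA) -/al; ring.
rewrite /sm_gamma num den ler_pdivrMr //; lra.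
Qed.

(** * The gap constant and the bound on the dynamic root *)

Lemma lam_lt_lam1 (R : realType) (n r m1 m2 : nat) (A : 'M[R]_n)
    (lam : nat -> R) (q : nat -> 'cV[R]_n) (i : nat) :
  spectral_notation A r m1 m2 lam q -> (m1 < i <= n)%N -> lam i < lam 1%N.
Proof.
move=> hA /andP[m1i iN]; have [m11 m12 m2r] := sn_m_bounds hA.
apply: le_lt_trans (lam_le hA _ m1i iN) _ => //.
rewrite -(sn_block1 hA (j := m1)) ?m11 ?leqnn //.
exact: (sn_gap1 hA).
Qed.

Lemma C_gap_ge0 (R : realType) (n r m1 m2 : nat) (A : 'M[R]_n)
    (lam : nat -> R) (q : nat -> 'cV[R]_n) :
  spectral_notation A r m1 m2 lam q -> 0 <= C_gap n r m1 m2 lam.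
Proof.
move=> hA; have [m11 m12 m2r] := sn_m_bounds hA.
have /andP[r1 rn] := sn_r_bounds hA.
have lr := sn_positive hA.
have l1 : 0 < lam 1%N by rewrite (lam_gt0 hA).
have lB : 0 < lam m1.+1 by rewrite (lam_gt0 hA) //= (leq_trans m12).
rewrite /C_gap; apply: mulr_ge0; last exact: ltW.
apply: mulr_ge0; first by rewrite mulr_ge0 ?invr_ge0 ?ler0n.
(* If [m2 = n], [lam m2.+1] is out of range and the denominator is only known to be nonnegative;
   since [x / 0 = 0], this suffices. *)
apply: addr_ge0 => //; apply: divr_ge0; apply: mulr_ge0; rewrite ?sqr_ge0 ?ltW //.
by rewrite mulr_gt0 // mulr_gt0 ?exprn_gt0 // ltr0n (leq_trans r1).
Qed.

(** As [lam_r <= lam_(m2+1) < lam_1], the quotient of squares is at least 1, so the fraction [X] is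
    at least [lam_1 / lam_r]; also [r - m1 >= 1]. This is what lets the constant absorb the
    intermediate block. *)
Lemma C_gap_lower (R : realType) (n r m1 m2 : nat) (A : 'M[R]_n)
    (lam : nat -> R) (q : nat -> 'cV[R]_n) :
  spectral_notation A r m1 m2 lam q -> (m2 < r)%N ->
  lam 1%N * lam m1.+1 <= 2 * C_gap n r m1 m2 lam * lam r.
Proof.
move=> hA m2r; have [m11 m12 _] := sn_m_bounds hA.
have /andP[r1 rn] := sn_r_bounds hA.
have lr := sn_positive hA.
have l1 : 0 < lam 1%N by rewrite (lam_gt0 hA).
have lB : 0 < lam m1.+1.
  by rewrite (lam_gt0 hA) //= (leq_trans m12) // ltnW.
have lm : lam m2.+1 < lam 1%N.
  by rewrite (lam_lt_lam1 hA) // ltnS (ltnW m12) (leq_trans m2r).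
have lrm : lam r <= lam m2.+1 by rewrite (lam_le hA).
rewrite /C_gap; set N := (r - m1)%:R; set X := _ / (lam r * _).
have N1 : 1 <= N by rewrite ler1n subn_gt0 (leq_trans m12) // ltnW.
have n1 : 1 <= n%:R :> R by rewrite ler1n (leq_trans r1).
have Xl : lam 1%N / lam r <= X.
  have m0 : 0 < lam 1%N - lam m2.+1 by lra.
  rewrite /X ler_pdivlMr; last by rewrite mulr_gt0 // exprn_gt0.
  rewrite mulrA divfK ?gt_eqF // -[leRHS]mulrA.
  have sq : (lam 1%N - lam m2.+1) ^+ 2 <= (lam 1%N - lam r) ^+ 2.
    by apply: lerXn2r; rewrite ?nnegrE; lra.
  have n21 : 1 <= n%:R ^+ 2 :> R by rewrite exprn_ege1.
  apply: (@le_trans _ _ (1 * (lam 1%N * (lam 1%N - lam r) ^+ 2))).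
    by rewrite mul1r ler_pM2l.
  by apply: ler_wpM2r; [rewrite mulr_ge0 ?sqr_ge0 // ltW | lra].
have {}Xl : lam 1%N <= (1 + X) * lam r.
  by move: Xl; rewrite ler_pdivrMr //; lra.
have -> : 2 * (2^-1 * N * (1 + X) * lam m1.+1) * lam r
  = N * ((1 + X) * lam r) * lam m1.+1 by field.
rewrite ler_pM2r //; apply: (le_trans Xl).
by rewrite ler_peMl // (le_trans (ltW l1)).
Qed.

(* If the block beyond [t] were empty, [x] would be a sum of a dominant and a
   null eigenvector, and the algorithm would have stopped. *)
Lemma lt_rank_of_running (R : realType) (n r m1 m2 : nat) (A : 'M[R]_n)
    (lam : nat -> R) (q : nat -> 'cV[R]_n) (x : 'cV[R]_n) (t : nat) (d : R) :
  spectral_notation A r m1 m2 lam q -> 0 < enorm (sm_res A x) ->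
  (m2 <= t)%N -> (t < n)%N ->
  \sum_(m1.+1 <= j < t.+1) dot (q j) x ^+ 2
    <= d * \sum_(t.+1 <= j < r.+1) dot (q j) x ^+ 2 ->
  (t < r)%N.
Proof.
move=> hA res0 m2t tn; rewrite ltnNge; apply: contraTN => rt.
rewrite [X in d * X]big_geq ?ltnS // mulr0 (sum_nat_ord _ _ (ltnW tn)) -ltNge.
have [m11 m12 m2r] := sn_m_bounds hA.
rewrite lt0r sumr_ge0 ?andbT => [|i _]; last by rewrite sqr_ge0.
apply/eqP => /psumr_eq0P inter0.
have a0 (i : 'I_n) : (m1 <= i < t)%N -> dot (q i.+1) x = 0.
  move=> it; apply/eqP; rewrite -sqrf_eq0; apply/eqP; apply: inter0 => // j _.
  by rewrite sqr_ge0.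
have S0 := dot_mulmx_gt0 hA res0.
(* With the intermediate coordinates zero, all remaining weight sits on [lam_1]. *)
have al1 : sm_alpha A x = lam 1%N.
  rewrite /sm_alpha; apply: (mulIf (lt0r_neq0 S0)); rewrite divfK ?gt_eqF //.
  rewrite (dot_mulmx_spectral _ hA) (dot_mulmx2_spectral _ hA) mulr_sumr.
  apply: eq_bigr => i _.
  have [im1|m1i] := ltnP i m1.
    by rewrite (sn_block1 hA (j := i.+1)) ?im1 //; ring.
  have [it|ti] := ltnP i t; first by rewrite a0 ?m1i //; ring.
  by rewrite (sn_zero hA (j := i.+1)) ?ltnS ?(leq_trans rt) ?ltn_ord //; ring.
have [i [li la ai]] := sm_res_ex hA res0.
have [im1|m1i] := ltnP i m1.
  by move: la; rewrite al1 (sn_block1 hA (j := i.+1)) ?im1 // eqxx.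
have [it|ti] := ltnP i t; first by move: ai; rewrite a0 ?m1i // eqxx.
move: li.
by rewrite (sn_zero hA (j := i.+1)) ?ltxx // ltnS (leq_trans rt) ?ltn_ord.
Qed.

Lemma sm_tau_lt (R : realType) (n r m1 m2 : nat) (A : 'M[R]_n)
    (lam : nat -> R) (q : nat -> 'cV[R]_n) (es : R) (x : 'cV[R]_n)
    (t : nat) (delta : R) :
  spectral_notation A r m1 m2 lam q -> 0 < es < 1 ->
  0 < enorm (sm_res A x) -> (m2 <= t)%N -> (t < n)%N ->
  \sum_(m1.+1 <= j < t.+1) dot (q j) x ^+ 2
    <= delta ^+ 2 * \sum_(t.+1 <= j < r.+1) dot (q j) x ^+ 2 ->
  sm_tau A es x
    < 2^-1 * (lam 1%N + lam t.+1) + C_gap n r m1 m2 lam * delta ^+ 2.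
Proof.
move=> hA es01 res0 m2t tn hT.
have tr := lt_rank_of_running hA res0 m2t tn hT.
have [m11 m12 m2r] := sn_m_bounds hA.
have /andP[r1 rn] := sn_r_bounds hA.
have m1t : (m1 < t)%N by rewrite (leq_trans m12).
have S0 := dot_mulmx_gt0 hA res0.
have C0 := C_gap_ge0 hA.
have ta := sm_tau_lt_alpha S0 es01; have tg := sm_tau_le_gamma S0 es01.
set C := C_gap _ _ _ _ _ in C0 *; set d := delta ^+ 2 in hT *.
(* Adding [tau < alpha] and [tau <= gamma] gives [2 tau < alpha + gamma]. *)
suff gl : sm_gamma A x <= lam 1%N + lam t.+1 - sm_alpha A x + 2 * C * d by lra.
move: hT; rewrite (sum_nat_ord _ _ (ltnW tn)) (sum_nat_ord _ _ rn) => hT.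
apply: (sm_gamma_moment hA res0).
have -> : lam 1%N + lam t.+1 - sm_alpha A x + 2 * C * d - sm_alpha A x
  = lam 1%N + lam t.+1 - 2 * sm_alpha A x + 2 * C * d by ring.
(* Ordinals are zero-based: [B] is the block [m1 + 1, ..., t] and [T] the block [t + 1, ..., r].
   Here [K = 2 C]. *)
apply: (third_moment_split (B := fun i : 'I_n => (m1 <= i < t)%N)
  (T := fun i : 'I_n => (t <= i < r)%N) (lB := lam m1.+1) (lr := lam r)) => //.
- exact: (sn_positive hA).
- by rewrite (lam_ge0 hA).
- by rewrite mulr_ge0.
- have lr := sn_positive hA.
  have := C_gap_lower hA (leq_ltn_trans m2t tr); rewrite -/C => Cl.
  have := mulr_ge0 C0 (ltW lr); lra.
- by move=> i; rewrite (lam_ge0 hA) ?(lam_le hA) //= ltn_ord.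
- exact: sm_alpha_mean hA S0.
- move=> i /andP[m1i it]; rewrite !(lam_le hA) //.
  + exact: ltnW.
- move=> i; rewrite negb_and -ltnNge -leqNgt => /orP[im1|ti].
    by left; apply: (sn_block1 hA).
  by right; rewrite (lam_le hA).
- by move=> i /andP[ti ir]; rewrite !(lam_le hA).
- exact: sqr_ge0.
Qed.

(** * Contraction and attenuation from the root bound *)

(** Given [li < l1], the claim amounts to [2 tau < l1 + li]. Since [lt - lt1 <= l1], one gets
    [e <= (lt - lt1) / 4], which keeps [tau] below [(l1 + lt) / 2]. *)
Lemma root_contraction (R : realFieldType) (l1 lt lt1 li tau e : R) :
  0 <= lt1 -> lt1 < lt -> lt <= li -> li < l1 ->
  tau < 2^-1 * (l1 + lt1) + e -> 4 * l1 * e <= (lt - lt1) ^+ 2 ->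
  `|li - tau| < l1 - tau.
Proof.
move=> lt10 gap tli li1 taub eb.
have l10 : 0 < l1 by lra.
have : e <= (lt - lt1) / 4.
  rewrite -(ler_pM2l l10).
  have : (lt - lt1) * (l1 - (lt - lt1)) >= 0 by apply: mulr_ge0; lra.
  lra.
move=> ?; rewrite ltr_norml; apply/andP; split; lra.
Qed.

(** The delicate case is [tau > lt1], where the claim reads [(lt + lt1) tau < lt l1 + lt1^2]. *)
Lemma root_attenuation (R : realFieldType) (l1 lt lt1 tau e : R) :
  0 <= lt1 -> lt1 < lt -> lt < l1 -> tau < l1 ->
  tau < 2^-1 * (l1 + lt1) + e -> 4 * l1 * e <= (lt - lt1) ^+ 2 ->
  lt1 * `|lt1 - tau| < lt * (l1 - tau).
Proof.
move=> lt10 gap lt1' tau1 taub eb.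
have [tl|lt_tau] := leP tau lt1.
  rewrite ger0_norm ?subr_ge0 //.
  have : lt1 * (lt1 - tau) <= lt * (lt1 - tau) by apply: ler_wpM2r; lra.
  have : lt * (lt1 - tau) < lt * (l1 - tau) by rewrite ltr_pM2l; lra.
  lra.
rewrite ltr0_norm ?subr_lt0 //.
have l10 : 0 < l1 by lra.
have s0 : 0 < lt + lt1 by lra.
(* At [tau = (l1 + lt1) / 2] the slack in that claim is exactly this right-hand side. *)
have eb' : (lt + lt1) * e <= (l1 - lt1) * (lt - lt1) / 2.
  rewrite -(ler_pM2l l10).
  have [e0|e0] := leP e 0.
    apply: (@le_trans _ _ 0).
      by rewrite mulr_ge0_le0 ?(ltW l10) // mulr_ge0_le0 // ltW.
    by rewrite mulr_ge0 ?(ltW l10) // divr_ge0 // mulr_ge0; lra.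
  have : (lt + lt1) * (l1 * e) <= 2 * l1 * (l1 * e).
    by apply: ler_wpM2r; [rewrite mulr_ge0 // ltW | lra].
  have : l1 * ((lt - lt1) * (lt - lt1)) <= l1 * ((l1 - lt1) * (lt - lt1)).
    by rewrite ler_pM2l // ler_wpM2r; lra.
  have : l1 * (4 * l1 * e) <= l1 * (lt - lt1) ^+ 2 by rewrite ler_pM2l.
  lra.
have : (lt + lt1) * tau < (lt + lt1) * (2^-1 * (l1 + lt1) + e).
  by rewrite ltr_pM2l.
have : 0 < (l1 - lt1) * (lt - lt1) by apply: mulr_gt0; lra.
lra.
Qed.

(** Makes the threshold uniform in [t]; the value 1 serves when no [f t] is positive. *)
Lemma exists_min_pos (R : realFieldType) (f : nat -> R) (n : nat) :
  exists g, 0 < g /\ forall t, (t < n)%N -> 0 < f t -> g <= f t.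
Proof.
elim: n => [|n [g [g0 hg]]]; first by exists 1.
have [fn|fn] := ltP 0 (f n); last first.
  exists g; split=> // t; rewrite ltnS leq_eqVlt => /orP[/eqP->|/hg //].
  by rewrite ltNge fn.
exists (Num.min g (f n)); split; first by rewrite lt_min g0.
move=> t; rewrite ltnS leq_eqVlt ge_min => /orP[/eqP-> _|tn ft].
  by rewrite lexx orbT.
by rewrite hg.
Qed.

(** * The dominant coordinate and the relative projections *)

(** By [dot_orth_proj] the product equals the norm of the projection. *)
Lemma dot_dominant_neq0 (R : realType) (n : nat) (U : 'M[R]_n)
    (x v : 'cV[R]_n) :
  orth_proj U x != 0 -> v = (enorm (orth_proj U x))^-1 *: orth_proj U x ->
  dot v x != 0.
Proof.
move=> P0 ->; rewrite dotZl dot_orth_proj mulf_neq0 ?dot_eq0 // invr_eq0.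
by rewrite -sqrf_eq0 enorm_sqr dot_eq0.
Qed.

(** Each step multiplies this coordinate by [omega lam_1 (lam_1 - tau)], positive because
    [tau < alpha <= lam_1]. *)
Lemma dot_sm_iterate_neq0 (R : realType) (n r m1 m2 : nat) (A : 'M[R]_n)
    (lam : nat -> R) (q : nat -> 'cV[R]_n) (eps es : R) (x0 : 'cV[R]_n)
    (k : nat) :
  spectral_notation A r m1 m2 lam q -> 0 < eps -> 0 < es < 1 ->
  dot (q 1%N) x0 != 0 -> sm_runs A es eps x0 k ->
  dot (q 1%N) (sm_iterate A es x0 k) != 0.
Proof.
move=> hA eps0 es01 a0; elim: k => [//|k IH] run.
have {}IH : dot (q 1%N) (sm_iterate A es x0 k) != 0.
  by apply: IH => j jk; apply: run; rewrite leqW.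
have res0 := lt_trans eps0 (run k (leqnSn k)).
have S0 := dot_mulmx_gt0 hA res0.
have /andP[r1 rn] := sn_r_bounds hA.
have n0 : (0 < n)%N := leq_trans r1 rn.
have l1 : 0 < lam 1%N by rewrite (lam_gt0 hA).
rewrite /sm_iterate iterS -/(sm_iterate A es x0 k).
rewrite (dot_sm_step S0 es01 (fun u => dot_eigvec u (Ordinal n0) hA)).
rewrite mulf_neq0 // mulf_neq0 ?gt_eqF ?sm_omega_gt0 //= mulr_gt0 // subr_gt0.
exact: lt_le_trans (sm_tau_lt_alpha S0 es01) (sm_alpha_le hA S0).
Qed.

(** The common factor [omega] cancels. Splitting the quotients needs no case distinction on zero
    denominators, as [x / 0 = 0]. *)
Lemma ratio_sm_step (R : realType) (n r m1 m2 : nat) (A : 'M[R]_n)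
    (lam : nat -> R) (q : nat -> 'cV[R]_n) (es : R) (x : 'cV[R]_n) (i : nat) :
  spectral_notation A r m1 m2 lam q -> 0 < es < 1 ->
  0 < enorm (sm_res A x) -> (1 <= i <= n)%N ->
  `|dot (q i) (sm_step A es x) / dot (q 1%N) (sm_step A es x)|
  = lam i / lam 1%N * attenuation A es (lam 1%N) x (lam i)
    * `|dot (q i) x / dot (q 1%N) x|.
Proof.
move=> hA es01 res0 /andP[i1 iN].
have S0 := dot_mulmx_gt0 hA res0.
have n0 : (0 < n)%N := leq_trans i1 iN.
have w0 := sm_omega_gt0 S0 es01.
have iN' : (i.-1 < n)%N by rewrite prednK.
have eqi u : dot (q i) (A *m u) = lam i * dot (q i) u.
  by have := dot_eigvec u (Ordinal iN') hA; rewrite /= prednK.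
rewrite (dot_sm_step S0 es01 eqi).
rewrite (dot_sm_step S0 es01 (fun u => dot_eigvec u (Ordinal n0) hA)) /=.
have -> : lam i / lam 1%N = `|lam i / lam 1%N|.
  by rewrite ger0_norm // divr_ge0 // (lam_ge0 hA) // ?i1.
rewrite /attenuation -!normrM; congr `|_|.
by rewrite -!mulf_div divff ?gt_eqF // mul1r.
Qed.

(** * The threshold and the conclusions *)

Unset Implicit Arguments.
Set Strict Implicit.

Theorem lemma5p5 (R : realType) (n r m1 m2 : nat) (A : 'M[R]_n)
    (lam : nat -> R) (q : nat -> 'cV[R]_n)
    (hA : spectral_notation A r m1 m2 lam q)
    (eps eps_sigma : R) (heps : 0 < eps)
    (heps_sigma : 0 < eps_sigma) (heps_sigma1 : eps_sigma < 1)
    (x0 : 'cV[R]_n)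
    (hx0 : 0 < dot x0 (A *m x0))
    (hP : orth_proj (dominant_eigenspace m1 q) x0 != 0)
    (hq1 : q 1%N =
       (enorm (orth_proj (dominant_eigenspace m1 q) x0))^-1
         *: orth_proj (dominant_eigenspace m1 q) x0) :
  let x := sm_iterate A eps_sigma x0 in
  exists delta_bar : R, 0 < delta_bar <= 1 /\
  forall (delta : R), 0 < delta < delta_bar ->
  forall (t : nat), (m2 <= t)%N -> (t < n)%N -> lam t.+1 < lam t ->
  forall (k : nat), sm_runs A eps_sigma eps x0 k ->
  \sum_(m1.+1 <= j < t.+1) dot (q j) (x k) ^+ 2
    <= delta ^+ 2 * dot (q 1%N) (x k) ^+ 2 ->
  \sum_(m1.+1 <= j < t.+1) dot (q j) (x k) ^+ 2
    <= delta ^+ 2 * \sum_(t.+1 <= j < r.+1) dot (q j) (x k) ^+ 2 ->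
  [/\ sm_tau A eps_sigma (x k)
        < 2^-1 * (lam 1%N + lam t.+1) + C_gap n r m1 m2 lam * delta ^+ 2,
      forall i, (m1.+1 <= i <= t)%N ->
        attenuation A eps_sigma (lam 1%N) (x k) (lam i) < 1 /\
        `|dot (q i) (x k.+1) / dot (q 1%N) (x k.+1)|
          = lam i / lam 1%N * attenuation A eps_sigma (lam 1%N) (x k) (lam i)
            * `|dot (q i) (x k) / dot (q 1%N) (x k)|
    & forall i, (t.+1 <= i <= n)%N -> lam i = lam t.+1 ->
        `|dot (q i) (x k.+1) / dot (q 1%N) (x k.+1)|
          <= lam t / lam 1%N * `|dot (q i) (x k) / dot (q 1%N) (x k)| /\
        (dot (q i) (x k) != 0 ->
         `|dot (q i) (x k.+1) / dot (q 1%N) (x k.+1)|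
           < lam t / lam 1%N * `|dot (q i) (x k) / dot (q 1%N) (x k)|)].
Proof.
move=> x.
have es01 : 0 < eps_sigma < 1 by rewrite heps_sigma.
have [m11 m12 m2r] := sn_m_bounds hA.
have /andP[r1 rn] := sn_r_bounds hA.
have l1 : 0 < lam 1%N by rewrite (lam_gt0 hA).
have C0 := C_gap_ge0 hA; set C := C_gap _ _ _ _ _ in C0 *.
have C10 : 0 < C + 1 by lra.
have [g [g0 hg]] := exists_min_pos (fun t => lam t - lam t.+1) n.
(* For [delta < 1] and [delta < D], [4 lam_1 C delta^2 <= 4 lam_1 (C + 1) delta <= g^2]; using
   [C + 1] keeps the denominator positive. *)
pose D := g ^+ 2 / (4 * lam 1%N * (C + 1)).
have D0 : 0 < D by rewrite divr_gt0 ?exprn_gt0 // !mulr_gt0.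
exists (Num.min 1 D); split; first by rewrite lt_min ltr01 D0 ge_min lexx.
move=> delta /andP[d0]; rewrite lt_min => /andP[d1 dD].
move=> t m2t tn gap k run _ hT.
have m1t : (m1 < t)%N := leq_trans m12 m2t.
have res0 := lt_trans heps (run k (leqnn k)).
have S0 := dot_mulmx_gt0 hA res0.
have tau_lt := sm_tau_lt hA es01 res0 m2t tn hT; rewrite -/C in tau_lt.
have tau1 : sm_tau A eps_sigma (x k) < lam 1%N.
  exact: lt_le_trans (sm_tau_lt_alpha S0 es01) (sm_alpha_le hA S0).
have lt10 : 0 <= lam t.+1 by rewrite (lam_ge0 hA).
(* The hypothesis shared by [root_contraction] and [root_attenuation], with [e = C delta^2]. *)
have eb : 4 * lam 1%N * (C * delta ^+ 2) <= (lam t - lam t.+1) ^+ 2.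
  have gt : g <= lam t - lam t.+1 by apply: hg; rewrite ?subr_gt0.
  apply: (@le_trans _ _ (g ^+ 2)); last by apply: lerXn2r; rewrite ?nnegrE; lra.
  have := ltW dD; rewrite ler_pdivlMr; last by rewrite !mulr_gt0.
  apply: le_trans.
  have -> : 4 * lam 1%N * (C * delta ^+ 2) = delta * (4 * lam 1%N * (C * delta)).
    by ring.
  rewrite !ler_pM2l // ?mulr_gt0 //.
  have : C * delta <= C * 1 by apply: ler_wpM2l; lra.
  lra.
have lam_inter i : (m1.+1 <= i <= t)%N -> lam t <= lam i /\ lam i < lam 1%N.
  move=> /andP[m1i it]; rewrite (lam_lt_lam1 hA) ?m1i ?(leq_trans it (ltnW tn)) //.
  by rewrite (lam_le hA) // ?(leq_trans _ m1i) // ltnW.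
have [_ ltl1] := lam_inter t (introT andP (conj m1t (leqnn t))).
have t1 : 0 < lam 1%N - sm_tau A eps_sigma (x k) by rewrite subr_gt0.
have attE l : attenuation A eps_sigma (lam 1%N) (x k) l
    = `|l - sm_tau A eps_sigma (x k)| / (lam 1%N - sm_tau A eps_sigma (x k)).
  by rewrite /attenuation normf_div (gtr0_norm t1).
split=> // i /andP[].
  move=> m1i it; have [tli li1] := lam_inter i (introT andP (conj m1i it)).
  split.
    by rewrite attE ltr_pdivrMr // mul1r; apply: root_contraction tau_lt eb.
  apply: (ratio_sm_step hA es01 res0).
  by rewrite (leq_trans _ m1i) // (leq_trans it) // ltnW.
move=> ti iN lit.
have coef : lam i / lam 1%N * attenuation A eps_sigma (lam 1%N) (x k) (lam i)
    < lam t / lam 1%N.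
  have -> : lam i / lam 1%N * attenuation A eps_sigma (lam 1%N) (x k) (lam i)
    = lam t.+1 * `|lam t.+1 - sm_tau A eps_sigma (x k)|
      / (lam 1%N - sm_tau A eps_sigma (x k)) / lam 1%N.
    by rewrite attE lit mulrAC !mulrA.
  rewrite ltr_pM2r ?invr_gt0 // ltr_pdivrMr //.
  exact: root_attenuation tau1 tau_lt eb.
have -> : x k.+1 = sm_step A eps_sigma (x k) by [].
rewrite (ratio_sm_step hA es01 res0) ?iN ?andbT ?(leq_trans _ ti) //.
split; first by apply: ler_wpM2r; rewrite ?normr_ge0 // ltW.
(* Strictness survives multiplication by a nonzero ratio, so the coordinate along [q_1] must be
   nonzero too. *)
move=> ai; rewrite ltr_pM2r // normr_gt0 mulf_neq0 // invr_eq0.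
apply: (dot_sm_iterate_neq0 hA heps es01) run.
exact: dot_dominant_neq0 hP hq1.
Qed.
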